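(* Let $C$ be a Reedy category. The quotient functor $q\colon\int N^{-,+}(C)\to\mathrm{Down}_*(C)$ exhibits $\mathrm{Down}_*(C)$ as the strict 1-localization of $\int N^{-,+}(C)$ at the set $W$ of morphisms of the form $(\sigma,\mathrm{id}_{X\circ\sigma})\colon([m],X\circ\sigma)\to([n],X)$ with $([n],X)$ an object and $\sigma\colon[m]\to[n]$ surjective. That is, $q$ sends every morphism in $W$ to an isomorphism, and every functor $G\colon\int N^{-,+}(C)\to E$ sending all morphisms of $W$ to isomorphisms factors as $G=H\circ q$ for a unique functor $H\colon\mathrm{Down}_*(C)\to E$.
   Context: A Reedy category $(C,C_-,C_+)$: wide subcategories with unique factorization of every morphism as ($C_-$ then $C_+$), membership in $C_\pm$ decidable, and the relation ($x<'y$ iff non-identity $x\to y$ in $C_+$ or non-identity $y\to x$ in $C_-$) well-founded. $\Delta$: finite ordinals $[n]$ and order-preserving maps. $\int N^{-,+}(C)$: objects $([n],X)$ with $X\colon[n]\to C$ a functor sending all morphisms into $C_-$; morphisms $([m],X)\to([n],Y)$ are $(\alpha,\theta)$ with $\alpha\colon[m]\to[n]$ in $\Delta$ and $\theta\colon X\Rightarrow Y\circ\alpha$ with all components in $C_+$; composition $(\beta,\varphi)\circ(\alpha,\theta)=(\beta\alpha,(\varphi\alpha)\circ\theta)$. Order on hom-sets: $(\alpha,\theta)\le(\alpha',\theta')$ iff $\alpha\le\alpha'$ pointwise and $\theta'_i=Y(\alpha(i)\le\alpha'(i))\circ\theta_i$ for all $i$ (compatible with composition). $\mathrm{Down}_*(C)$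 has the same objects as $\int N^{-,+}(C)$ and hom-sets the quotients by the equivalence relation generated by $\le$; $q$ is the identity on objects and the quotient map on morphisms. *)

(* Defs.v *)
From Stdlib Require Import ClassicalEpsilon Relation_Operators.
From mathcomp Require Import all_boot.

Set Implicit Arguments.
Unset Strict Implicit.
Unset Printing Implicit Defensive.

Record Cat := {
  ob :> Type;
  hom : ob -> ob -> Type;
  idm : forall x, hom x x;
  cmp : forall x y z, hom y z -> hom x y -> hom x z }.
Arguments hom {c}.
Arguments idm {c} x.
Arguments cmp {c x y z}.

Definition is_category (C : Cat) : Prop :=
  (forall (x y : C) (f : hom x y), cmp (idm y) f = f) /\
  (forall (x y : C) (f : hom x y), cmp f (idm x) = f) /\
  (forall (x y z w : C) (f : hom x y) (g : hom y z) (h : hom z w),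
      cmp h (cmp g f) = cmp (cmp h g) f).

Definition arrow (C : Cat) := {x : C & {y : C & hom x y}}.
Definition arr (C : Cat) (x y : C) (f : hom x y) : arrow C :=
  existT _ x (existT _ y f).

Definition is_iso (C : Cat) (x y : C) (f : hom x y) : Prop :=
  exists g : hom y x, cmp g f = idm x /\ cmp f g = idm y.

Record Functor (C D : Cat) := {
  fob :> C -> D;
  fmap : forall x y : C, hom x y -> hom (fob x) (fob y) }.
Arguments fmap {C D} f {x y} : rename.

Definition is_functor (C D : Cat) (F : Functor C D) : Prop :=
  (forall x : C, fmap F (idm x) = idm (F x)) /\
  (forall (x y z : C) (g : hom y z) (f : hom x y),
      fmap F (cmp g f) = cmp (fmap F g) (fmap F f)).

Definition fcomp (C D E : Cat) (G : Functor D E) (F : Functor C D) : Functor C E :=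
  {| fob := fun x => G (F x); fmap := fun x y f => fmap G (fmap F f) |}.

(* strict equality of functors: same action on every arrow (incl. source/target) *)
Definition functor_eq (C D : Cat) (F G : Functor C D) : Prop :=
  forall (x y : C) (f : hom x y), arr (fmap F f) = arr (fmap G f).

Definition reedy_lt (C : Cat) (m p : forall x y : C, hom x y -> bool) (x y : C) : Prop :=
  (exists f : hom x y, p x y f /\ arr f <> arr (idm x)) \/
  (exists f : hom y x, m y x f /\ arr f <> arr (idm y)).

Record Reedy := {
  RC :> Cat;
  RC_cat : is_category RC;
  Rminus : forall x y : RC, hom x y -> bool;
  Rplus : forall x y : RC, hom x y -> bool;
  Rminus_id : forall x : RC, Rminus (idm x);
  Rminus_cmp : forall (x y z : RC) (g : hom y z) (f : hom x y),
      Rminus g -> Rminus f -> Rminus (cmp g f);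
  Rplus_id : forall x : RC, Rplus (idm x);
  Rplus_cmp : forall (x y z : RC) (g : hom y z) (f : hom x y),
      Rplus g -> Rplus f -> Rplus (cmp g f);
  Rfact_ex : forall (x z : RC) (f : hom x z),
      exists (y : RC) (g : hom x y) (h : hom y z),
        Rminus g /\ Rplus h /\ cmp h g = f;
  Rfact_uniq : forall (x z : RC) (f : hom x z)
      (y : RC) (g : hom x y) (h : hom y z) (y' : RC) (g' : hom x y') (h' : hom y' z),
      Rminus g -> Rplus h -> cmp h g = f ->
      Rminus g' -> Rplus h' -> cmp h' g' = f ->
      existT (fun y => (hom x y * hom y z)%type) y (g, h) =
      existT (fun y => (hom x y * hom y z)%type) y' (g', h');
  Rwf : well_founded (reedy_lt Rminus Rplus) }.
Arguments Rminus {r x y}.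
Arguments Rplus {r x y}.

(* ---------- Delta: maps [m] -> [n], [n] = 'I_n.+1 ---------- *)
Definition dmap (m n : nat) :=
  {f : 'I_m.+1 -> 'I_n.+1 | forall i j : 'I_m.+1, i <= j -> f i <= f j}.
Definition dmap_mono (m n : nat) (a : dmap m n) (i j : 'I_m.+1) (h : i <= j)
  : sval a i <= sval a j := proj2_sig a i j h.
Definition dmap_id (n : nat) : dmap n n :=
  exist (fun f : 'I_n.+1 -> 'I_n.+1 => forall i j : 'I__, i <= j -> f i <= f j)
        (fun i => i) (fun i j h => h).
Definition dmap_comp (l m n : nat) (b : dmap m n) (a : dmap l m) : dmap l n :=
  exist (fun f : 'I_l.+1 -> 'I_n.+1 => forall i j : 'I__, i <= j -> f i <= f j)
        (fun i => sval b (sval a i)) (fun i j h => dmap_mono b (dmap_mono a h)).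
Definition dsurj (m n : nat) (a : dmap m n) : Prop :=
  forall j : 'I_n.+1, exists i : 'I_m.+1, sval a i = j.

Section IntN.
Variable R : Reedy.

(* objects ([n], X) with X : [n] -> C a functor landing in C_- *)
Record NObj := {
  ndim : nat;
  nX : 'I_ndim.+1 -> R;
  nXm : forall i j : 'I_ndim.+1, i <= j -> hom (nX i) (nX j);
  nX_id : forall (i : 'I_ndim.+1) (h : i <= i), nXm h = idm (nX i);
  nX_cmp : forall (i j k : 'I_ndim.+1) (h1 : i <= j) (h2 : j <= k) (h3 : i <= k),
      cmp (nXm h2) (nXm h1) = nXm h3;
  nX_minus : forall (i j : 'I_ndim.+1) (h : i <= j), Rminus (nXm h) }.
Arguments nXm n {i j}.
Arguments nX n i : clear implicits.
Arguments ndim n : clear implicits.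

(* morphisms (alpha, theta) with theta : X => Y o alpha, components in C_+ *)
Record NHom (a b : NObj) := {
  nal : dmap (ndim a) (ndim b);
  nth_ : forall i : 'I_(ndim a).+1, hom (nX a i) (nX b (sval nal i));
  nth_plus : forall i, Rplus (nth_ i);
  nth_nat : forall (i j : 'I_(ndim a).+1) (h : i <= j),
      cmp (nXm b (dmap_mono nal h)) (nth_ i) = cmp (nth_ j) (nXm a h) }.
Arguments nal {a b} n.
Arguments nth_ {a b} n i.

Let hC := RC_cat R.

Definition nid (a : NObj) : NHom a a.
Proof.
refine {| nal := dmap_id (ndim a);
          nth_ := fun i => idm (nX a i) |}.
- move=> i; exact: Rplus_id.
- move=> i j h /=. case: hC => [l [r _]]. by rewrite l r.
Defined.

Definition ncomp (a b c : NObj) (g : NHom b c) (f : NHom a b) : NHom a c.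
Proof.
refine {| nal := dmap_comp (nal g) (nal f);
          nth_ := fun i => cmp (nth_ g (sval (nal f) i)) (nth_ f i) |}.
- move=> i; apply: Rplus_cmp; [exact: nth_plus | exact: nth_plus].
- move=> i j h /=. case: hC => [_ [_ hA]].
  rewrite hA (nth_nat g (dmap_mono (nal f) h)) -hA (nth_nat f h) hA //.
Defined.

Definition intN : Cat :=
  {| ob := NObj; hom := NHom; idm := nid; cmp := fun a b c g f => ncomp g f |}.

Definition nle (a b : NObj) (f f' : NHom a b) : Prop :=
  exists H : forall i, sval (nal f) i <= sval (nal f') i,
    forall i, nth_ f' i = cmp (nXm b (H i)) (nth_ f i).

Definition ncls (a b : NObj) (f : NHom a b) : NHom a b -> Prop :=
  fun g => clos_refl_sym_trans _ (@nle a b) f g.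

Definition DHom (a b : NObj) := {S : NHom a b -> Prop | exists f, S = ncls f}.
Definition dclass (a b : NObj) (f : NHom a b) : DHom a b :=
  exist _ (ncls f) (ex_intro _ f erefl).
Definition drep (a b : NObj) (S : DHom a b) : NHom a b :=
  proj1_sig (constructive_indefinite_description _ (proj2_sig S)).

Definition Down : Cat :=
  {| ob := NObj; hom := DHom;
     idm := fun a => dclass (nid a);
     cmp := fun a b c T S => dclass (ncomp (drep T) (drep S)) |}.

Definition qfun : Functor intN Down :=
  @Build_Functor intN Down (fun a : NObj => a) (fun (a b : NObj) (f : NHom a b) => dclass f).

Definition restr (b : NObj) (m : nat) (s : dmap m (ndim b)) : NObj.
Proof.
refine {| ndim := m; nX := fun i => nX b (sval s i);
          nXm := fun i j h => nXm b (dmap_mono s h) |}.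
- move=> i h; exact: nX_id.
- move=> i j k h1 h2 h3; exact: nX_cmp.
- move=> i j h; exact: nX_minus.
Defined.

Definition Wmor (b : NObj) (m : nat) (s : dmap m (ndim b)) : NHom (restr s) b.
Proof.
refine (@Build_NHom (restr s) b s (fun i => idm (nX b (sval s i))) _ _).
- move=> i; exact: Rplus_id.
- move=> i j h /=. case: hC => [l [r _]]. by rewrite l r.
Defined.

End IntN.

Definition inverts_W (R : Reedy) (E : Cat) (F : Functor (intN R) E) : Prop :=
  forall (b : NObj R) (m : nat) (s : dmap m (ndim b)),
    dsurj s -> is_iso (fmap F (Wmor s)).

(* Main.v *)
(* Given f <= f' out of ([m], X), the maps f_k which
   follow f on the vertices i < k and f' on the others interpolate from
   f_0 = f' to f_(m+1) = f, and f_k, f_(k+1) factor through one and the same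
   map out of ([m+1], X o s^k) along the two sections d^k, d^(k+1) of the
   codegeneracy s^k.  Since (s^k, id) lies in W, a functor inverting W sends
   both sections to the inverse of its image, hence identifies f_k and
   f_(k+1).  Conversely q inverts W: a surjection s has the section d choosing
   least preimages, and d s <= id. *)
Require Import Defs.
From Stdlib Require Import ClassicalEpsilon Relation_Operators.
From Stdlib Require Import ProofIrrelevance FunctionalExtensionality PropExtensionality.
From mathcomp Require Import all_boot zify.

Set Implicit Arguments.
Unset Strict Implicit.
Unset Printing Implicit Defensive.

Section CategoryLaws.
Variables (C : Cat) (hC : is_category C).

Lemma cmp1f (x y : C) (f : hom x y) : cmp (idm y) f = f.
Proof. by case: hC => l _; apply: l. Qed.

Lemma cmpf1 (x y : C) (f : hom x y) : cmp f (idm x) = f.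
Proof. by case: hC => _ [r _]; apply: r. Qed.

Lemma cmpA (x y z w : C) (f : hom x y) (g : hom y z) (h : hom z w) :
  cmp h (cmp g f) = cmp (cmp h g) f.
Proof. by case: hC => _ [_ a]; apply: a. Qed.

Lemma iso_section_unique (x y : C) (w : hom x y) (d d' : hom y x) :
  is_iso w -> cmp w d = idm y -> cmp w d' = idm y -> d = d'.
Proof.
case=> v [vw _] wd wd'.
by rewrite -[d]cmp1f -vw -cmpA wd cmpf1 -[v]cmpf1 -wd' cmpA vw cmp1f.
Qed.

End CategoryLaws.

Section FunctorLaws.
Variables (C D : Cat) (F : Functor C D) (hF : is_functor F).

Lemma fmap1 (x : C) : fmap F (idm x) = idm (F x).
Proof. exact: (proj1 hF). Qed.

Lemma fmapM (x y z : C) (g : hom y z) (f : hom x y) :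
  fmap F (cmp g f) = cmp (fmap F g) (fmap F f).
Proof. exact: (proj2 hF). Qed.

Lemma fmap_section (x y : C) (w : hom x y) (d : hom y x) :
  cmp w d = idm y -> cmp (fmap F w) (fmap F d) = idm (F y).
Proof. by move=> wd; rewrite -fmapM wd fmap1. Qed.

End FunctorLaws.

Lemma arr_inj (C : Cat) (x y : C) (f g : hom x y) : arr f = arr g -> f = g.
Proof. by move=> e; do 2 apply inj_pair2 in e. Qed.

Lemma clos_rst_map (A B : Type) (RA : A -> A -> Prop) (RB : B -> B -> Prop)
    (F : A -> B) :
  (forall x y, RA x y -> RB (F x) (F y)) ->
  forall x y, clos_refl_sym_trans A RA x y -> clos_refl_sym_trans B RB (F x) (F y).
Proof.
move=> hF x y; elim=> [u v /hF|u|u v _|u v w _ IH1 _ IH2].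
- exact: rst_step.
- exact: rst_refl.
- exact: rst_sym.
- exact: rst_trans IH1 IH2.
Qed.

Lemma clos_rst_const (A B : Type) (RA : A -> A -> Prop) (F : A -> B) :
  (forall x y, RA x y -> F x = F y) ->
  forall x y, clos_refl_sym_trans A RA x y -> F x = F y.
Proof. by move=> hF x y; elim=> [u v /hF| | |u v w _ -> _ ->]. Qed.

Lemma dmap_ext (m n : nat) (a b : dmap m n) : sval a =1 sval b -> a = b.
Proof.
case: a b => [fa pa] [fb pb] /= /functional_extensionality e; subst fb.
by rewrite (proof_irrelevance _ pa pb).
Qed.

Lemma dsurj_least_section (m n : nat) (s : dmap m n) : dsurj s ->
  exists d : dmap n m, (forall j, sval s (sval d j) = j) /\
                       (forall i, sval d (sval s i) <= i).
Proof.
move=> surj.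
have ex_pre (j : 'I_n.+1) : exists k, (k < m.+1) && (sval s (inord k) == j).
  by case: (surj j) => i <-; exists i; rewrite ltn_ord inord_val eqxx.
pose d j : 'I_m.+1 := inord (ex_minn (ex_pre j)).
have sd j : sval s (d j) = j by rewrite /d; case: ex_minnP => k /andP[_ /eqP].
have ds i : d (sval s i) <= i.
  rewrite /d; case: ex_minnP => k /andP[lt_km _] min_k.
  by rewrite inordK // min_k // ltn_ord inord_val eqxx.
have d_mono (j j' : 'I_n.+1) : j <= j' -> d j <= d j'.
  move=> le_jj'; rewrite leqNgt; apply/negP => lt_d.
  have := dmap_mono s (ltnW lt_d); rewrite !sd => le_j'j.
  have /val_inj e : val j = val j' by apply/anti_leq/andP.
  by move: lt_d; rewrite e ltnn.
by exists (exist _ d d_mono).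
Qed.

(* The codegeneracy s^k : [m+1] -> [m] hits k twice; the clamp by m only
   matters for k > m, where it keeps the map well defined. *)
Definition codegen_fun (m k : nat) (i : 'I_m.+2) : 'I_m.+1 :=
  inord (minn (if i <= k then i : nat else i.-1) m).

Lemma codegen_val m k (i : 'I_m.+2) :
  (codegen_fun k i : nat) = minn (if i <= k then i : nat else i.-1) m.
Proof. by rewrite inordK //; lia. Qed.

Lemma codegen_mono m k (i j : 'I_m.+2) : i <= j -> codegen_fun k i <= codegen_fun k j.
Proof. by move=> le_ij; rewrite !codegen_val; case: ifP; case: ifP; lia. Qed.

Definition codegen (m k : nat) : dmap m.+1 m := exist _ _ (@codegen_mono m k).

Definition coface_fun (m k : nat) (i : 'I_m.+1) : 'I_m.+2 :=
  inord (if i < k then i : nat else i.+1).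

Lemma coface_val m k (i : 'I_m.+1) :
  (coface_fun k i : nat) = if i < k then i : nat else i.+1.
Proof. by rewrite inordK //; have := ltn_ord i; case: ifP; lia. Qed.

Lemma coface_mono m k (i j : 'I_m.+1) : i <= j -> coface_fun k i <= coface_fun k j.
Proof. by move=> le_ij; rewrite !coface_val; case: ifP; case: ifP; lia. Qed.

Definition coface (m k : nat) : dmap m m.+1 := exist _ _ (@coface_mono m k).

Lemma codegen_coface m k k' (i : 'I_m.+1) :
  k <= k' <= k.+1 -> sval (codegen m k) (sval (coface m k') i) = i.
Proof.
move=> hk; apply: val_inj; rewrite /= codegen_val coface_val.
by have := ltn_ord i; case: ifP; case: ifP; lia.
Qed.

Lemma coface_leq m k k' (i : 'I_m.+1) :
  k <= k' <= k.+1 -> (sval (coface m k') i <= k) = (i < k').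
Proof. by move=> hk; rewrite /= coface_val; case: ifP; lia. Qed.

Lemma codegen_surj m k : dsurj (codegen m k).
Proof.
move=> j; exists (sval (coface m k) j); apply: codegen_coface.
by rewrite leqnn leqnSn.
Qed.

Section IntN.
Variable R : Reedy.
Let hR := RC_cat R.

Lemma NHom_ext (a b : NObj R) (f g : NHom a b) :
  sval (nal f) =1 sval (nal g) -> (forall i, arr (nth_ f i) = arr (nth_ g i)) ->
  f = g.
Proof.
case: f g => al th thp thn [al' th' thp' thn'] /= /dmap_ext e1 e2; subst al'.
have e : th = th'.
  by apply: functional_extensionality_dep => i; apply: arr_inj.
subst th'; f_equal; exact: proof_irrelevance.
Qed.

Lemma nXm_irrelevance (A : NObj R) (i j : 'I_(ndim A).+1) (h h' : i <= j) :
  nXm h = nXm h'.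
Proof. by rewrite (bool_irrelevance h h'). Qed.

Lemma nXm_trans (A : NObj R) (i j k : 'I_(ndim A).+1) (h1 : i <= j) (h2 : j <= k) :
  cmp (nXm h2) (nXm h1) = nXm (leq_trans h1 h2).
Proof. exact: nX_cmp. Qed.

Lemma nXm_idm (A : NObj R) (i j : 'I_(ndim A).+1) (h : i <= j) :
  i = j -> arr (nXm h) = arr (idm (nX i)).
Proof. by move=> e; subst j; rewrite nX_id. Qed.

Lemma nXm_plus (A : NObj R) (i j : 'I_(ndim A).+1) (h : i <= j) :
  i = j -> Rplus (nXm h).
Proof. by move=> e; subst j; rewrite nX_id; exact: Rplus_id. Qed.

Lemma arr_cmp_nXm (A : NObj R) (x : R) (i j j' : 'I_(ndim A).+1)
    (h : i <= j) (h' : i <= j') (g : hom x (nX i)) :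
  j = j' -> arr (cmp (nXm h) g) = arr (cmp (nXm h') g).
Proof. by move=> e; subst j'; rewrite (nXm_irrelevance h h'). Qed.

Lemma intN_cat : is_category (intN R).
Proof.
split; [|split].
- by move=> x y f; apply: NHom_ext => //= i; rewrite (cmp1f hR).
- by move=> x y f; apply: NHom_ext => //= i; rewrite (cmpf1 hR).
- by move=> x y z w f g h; apply: NHom_ext => //= i; rewrite (cmpA hR).
Qed.

Lemma ncomp1f (a b : NObj R) (f : NHom a b) : ncomp (nid b) f = f.
Proof. exact: (cmp1f intN_cat). Qed.

Lemma ncompf1 (a b : NObj R) (f : NHom a b) : ncomp f (nid a) = f.
Proof. exact: (cmpf1 intN_cat). Qed.

Lemma ncompA (a b c d : NObj R) (f : NHom a b) (g : NHom b c) (h : NHom c d) :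
  ncomp h (ncomp g f) = ncomp (ncomp h g) f.
Proof. exact: (cmpA intN_cat). Qed.

Lemma nle_al (a b : NObj R) (f f' : NHom a b) :
  nle f f' -> forall i, sval (nal f) i <= sval (nal f') i.
Proof. by case. Qed.

Lemma nle_nth (a b : NObj R) (f f' : NHom a b) : nle f f' ->
  forall i (h : sval (nal f) i <= sval (nal f') i),
  nth_ f' i = cmp (nXm h) (nth_ f i).
Proof. by case=> H HH i h; rewrite HH (nXm_irrelevance (H i) h). Qed.

Lemma nle_compl (a b c : NObj R) (g : NHom b c) (f f' : NHom a b) :
  nle f f' -> nle (ncomp g f) (ncomp g f').
Proof.
case=> H HH; exists (fun i => dmap_mono (nal g) (H i)) => i /=.
by rewrite HH (cmpA hR) -(nth_nat g (H i)) -(cmpA hR).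
Qed.

Lemma nle_compr (a b d : NObj R) (h : NHom d a) (f f' : NHom a b) :
  nle f f' -> nle (ncomp f h) (ncomp f' h).
Proof.
by case=> H HH; exists (fun j => H (sval (nal h) j)) => j /=; rewrite HH (cmpA hR).
Qed.

Lemma ncls_comp (a b c : NObj R) (g g' : NHom b c) (f f' : NHom a b) :
  ncls f f' -> ncls g g' -> ncls (ncomp g f) (ncomp g' f').
Proof.
move=> ff' gg'; apply: rst_trans.
- exact: clos_rst_map (@nle_compl _ _ _ g) _ _ ff'.
- exact: clos_rst_map (fun x y => @nle_compr _ _ _ f' x y) _ _ gg'.
Qed.

Lemma dclass_eq (a b : NObj R) (f g : NHom a b) : ncls f g -> dclass f = dclass g.
Proof.
move=> fg.
have e : ncls f = ncls g.
  apply: functional_extensionality => h; apply: propositional_extensionality.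
  by split=> [|gh]; [apply: rst_trans; apply: rst_sym | apply: rst_trans gh].
rewrite /dclass; move: (ex_intro _ f _) (ex_intro _ g _); rewrite e => p q.
by rewrite (proof_irrelevance _ p q).
Qed.

Lemma drepK (a b : NObj R) (S : DHom a b) : dclass (drep S) = S.
Proof.
rewrite /drep /dclass; case: (constructive_indefinite_description _ _) => f /= e.
by case: S e => S0 p /= e; subst S0; f_equal; exact: proof_irrelevance.
Qed.

Lemma ncls_drep (a b : NObj R) (f : NHom a b) : ncls f (drep (dclass f)).
Proof.
rewrite /drep /dclass; case: (constructive_indefinite_description _ _) => g /= ->.
exact: rst_refl.
Qed.

Lemma cmp_dclass (a b c : NObj R) (g : NHom b c) (f : NHom a b) :
  @cmp (Down R) a b c (dclass g) (dclass f) = dclass (ncomp g f).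
Proof. by apply/dclass_eq/ncls_comp; apply: rst_sym; exact: ncls_drep. Qed.

Lemma Down_cat : is_category (Down R).
Proof.
split; [|split].
- by move=> x y S; rewrite -(drepK S) -[idm y]/(dclass (nid y)) cmp_dclass ncomp1f.
- by move=> x y S; rewrite -(drepK S) -[idm x]/(dclass (nid x)) cmp_dclass ncompf1.
- move=> x y z w f g h; rewrite -(drepK f) -(drepK g) -(drepK h).
  by rewrite !cmp_dclass ncompA.
Qed.

Lemma qfun_functor : is_functor (qfun R).
Proof. by split=> // x y z g f; symmetry; exact: cmp_dclass. Qed.

Section WSection.
Variables (A : NObj R) (p : nat) (s : dmap p (ndim A)) (d : dmap (ndim A) p).
Hypothesis sd : forall i, sval s (sval d i) = i.

Lemma leq_sd (i : 'I_(ndim A).+1) : i <= sval s (sval d i).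
Proof. by rewrite sd. Qed.

Definition Wsection : NHom A (restr s).
Proof.
refine (@Build_NHom R A (restr s) d (fun i => nXm (leq_sd i)) _ _).
- by move=> i; apply: nXm_plus; rewrite sd.
- by move=> i j h /=; rewrite !nXm_trans; exact: nXm_irrelevance.
Defined.

Lemma Wmor_Wsection : ncomp (Wmor s) Wsection = nid A.
Proof. by apply: NHom_ext => //= i; rewrite (cmp1f hR); apply: nXm_idm; rewrite sd. Qed.

End WSection.

Lemma qfun_inverts_W : inverts_W (qfun R).
Proof.
move=> b m s /dsurj_least_section[d [sd ds]].
exists (dclass (Wsection sd)); split; rewrite [cmp _ _]cmp_dclass.
- apply/dclass_eq/rst_step; exists ds => i /=.
  by apply: arr_inj; rewrite (cmpf1 hR) nXm_trans nXm_idm.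
- by rewrite Wmor_Wsection.
Qed.

Section Interpolation.
Variables (A B : NObj R) (f f' : NHom A B).
Hypothesis ff' : nle f f'.
Variable k : nat.

Definition interp_fun (i : 'I_(ndim A).+1) : 'I_(ndim B).+1 :=
  if i < k then sval (nal f) i else sval (nal f') i.

Lemma interp_mono (i j : 'I_(ndim A).+1) : i <= j -> interp_fun i <= interp_fun j.
Proof.
move=> le_ij; rewrite /interp_fun.
have := dmap_mono (nal f) le_ij; have := dmap_mono (nal f') le_ij.
have := nle_al ff' i; have := nle_al ff' j.
by case: ifP; case: ifP; lia.
Qed.

Lemma leq_interp (i : 'I_(ndim A).+1) : sval (nal f) i <= interp_fun i.
Proof. by rewrite /interp_fun; case: ifP => // _; exact: nle_al. Qed.

Lemma interp_plus (i : 'I_(ndim A).+1) : Rplus (cmp (nXm (leq_interp i)) (nth_ f i)).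
Proof.
move: (leq_interp i); rewrite /interp_fun; case: ifP => _ h.
- by rewrite nX_id (cmp1f hR); exact: nth_plus.
- by rewrite -(nle_nth ff'); exact: nth_plus.
Qed.

Definition interp : NHom A B.
Proof.
refine (@Build_NHom R A B (exist _ interp_fun interp_mono)
          (fun i => cmp (nXm (leq_interp i)) (nth_ f i)) interp_plus _).
move=> i j h /=.
rewrite (cmpA hR) nXm_trans -(cmpA hR) -(nth_nat f h) (cmpA hR) nXm_trans.
by congr cmp; exact: nXm_irrelevance.
Defined.

End Interpolation.

Lemma interp0 (A B : NObj R) (f f' : NHom A B) (ff' : nle f f') : interp ff' 0 = f'.
Proof.
apply: NHom_ext => //= i; rewrite (nle_nth ff' (nle_al ff' i)).
by apply: arr_cmp_nXm; rewrite /interp_fun ltn0.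
Qed.

Lemma interp_all (A B : NObj R) (f f' : NHom A B) (ff' : nle f f') :
  interp ff' (ndim A).+1 = f.
Proof.
have all_lt (i : 'I_(ndim A).+1) : interp_fun f f' (ndim A).+1 i = sval (nal f) i.
  by rewrite /interp_fun ltn_ord.
apply: NHom_ext => //= i; rewrite -[in RHS](cmp1f hR (nth_ f i)) -(nX_id (leqnn _)).
exact/arr_cmp_nXm/all_lt.
Qed.

Lemma interp_factor (A B : NObj R) (f f' : NHom A B) (ff' : nle f f') k k'
    (hk : k <= k' <= k.+1) :
  let s := codegen (ndim A) k in
  ncomp (interp (nle_compr (Wmor s) ff') k.+1)
        (Wsection (fun i => codegen_coface i hk)) = interp ff' k'.
Proof.
have e i : interp_fun (ncomp f (Wmor (codegen (ndim A) k)))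
                      (ncomp f' (Wmor (codegen (ndim A) k))) k.+1
                      (sval (coface (ndim A) k') i) = interp_fun f f' k' i.
  have /= sd := codegen_coface i hk.
  by rewrite /interp_fun /= ltnS (coface_leq i hk) sd.
apply: NHom_ext => //= i.
rewrite (cmpf1 hR) -(cmpA hR) -(nth_nat f) (cmpA hR) nXm_trans.
exact/arr_cmp_nXm/e.
Qed.

Section UniversalProperty.
Variables (E : Cat) (hE : is_category E) (G : Functor (intN R) E).
Hypotheses (hG : is_functor G) (hW : inverts_W G).

Lemma fmap_interpS (A B : NObj R) (f f' : NHom A B) (ff' : nle f f') k :
  fmap G (interp ff' k) = fmap G (interp ff' k.+1).
Proof.
have hk : k <= k <= k.+1 by rewrite leqnn leqnSn.
have hk1 : k <= k.+1 <= k.+1 by rewrite leqnn leqnSn.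
rewrite -(interp_factor ff' hk) -(interp_factor ff' hk1) !(fmapM hG).
congr (cmp _ _); apply: (iso_section_unique hE (hW (codegen_surj k))).
all: by apply: (fmap_section hG); exact: Wmor_Wsection.
Qed.

Lemma fmap_nle (A B : NObj R) (f f' : NHom A B) : nle f f' -> fmap G f = fmap G f'.
Proof.
move=> ff'; have fmap_interp k : fmap G (interp ff' k) = fmap G (interp ff' 0).
  by elim: k => [|k IH] //; rewrite -fmap_interpS.
by rewrite -[in LHS](interp_all ff') fmap_interp interp0.
Qed.

Lemma fmap_ncls (A B : NObj R) (f f' : NHom A B) : ncls f f' -> fmap G f = fmap G f'.
Proof. exact: (@clos_rst_const _ _ _ (fmap G) (@fmap_nle A B)). Qed.

Definition Down_lift : Functor (Down R) E :=
  @Build_Functor (Down R) E (fun a => G a) (fun a b S => fmap G (drep S)).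

Lemma Down_lift_functor : is_functor Down_lift.
Proof.
split=> [x|x y z g f] /=.
- by rewrite -(fmap_ncls (ncls_drep (nid x))) (fmap1 hG).
- by rewrite -(fmap_ncls (ncls_drep _)) (fmapM hG).
Qed.

Lemma Down_lift_fac : functor_eq G (fcomp Down_lift (qfun R)).
Proof. by move=> x y f /=; rewrite -(fmap_ncls (ncls_drep f)). Qed.

Lemma Down_lift_unique (H : Functor (Down R) E) :
  functor_eq G (fcomp H (qfun R)) -> functor_eq Down_lift H.
Proof. by move=> GH x y S; have := GH x y (drep S); rewrite /= drepK. Qed.

End UniversalProperty.

End IntN.

Theorem proposition6p3 (R : Reedy) :
  is_category (intN R) /\ is_category (Down R) /\ is_functor (qfun R) /\
  inverts_W (qfun R) /\
  (forall (E : Cat), is_category E ->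
   forall G : Functor (intN R) E, is_functor G -> inverts_W G ->
   exists H : Functor (Down R) E,
     is_functor H /\ functor_eq G (fcomp H (qfun R)) /\
     forall H' : Functor (Down R) E,
       is_functor H' -> functor_eq G (fcomp H' (qfun R)) -> functor_eq H H').
Proof.
split; first exact: intN_cat.
split; first exact: Down_cat.
split; first exact: qfun_functor.
split; first exact: qfun_inverts_W.
move=> E hE G hG hW; exists (Down_lift G).
split; first exact: Down_lift_functor.
split; first exact: Down_lift_fac.
by move=> H' _; exact: Down_lift_unique.
Qed.
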